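(* Let $k/F$ be an extension of fields with $F$ a perfect field. If $f:A\rightarrow k$ is a surjective morphism of $F$-algebras with nilpotent kernel, then there is a ring map $g:k\rightarrow A$ such that $fg:k\rightarrow k$ is the identity map.
   Context: All rings and algebras are commutative with $1$, and ring maps preserve $1$. An ideal $I$ is nilpotent if $I^{n}=0$ for some $n\geqslant1$. *)

(* Defs.v *)
From HB Require Import structures.
From mathcomp Require Import all_boot all_order all_algebra all_field.

Set Implicit Arguments.
Unset Strict Implicit.
Unset Printing Implicit Defensive.

Import GRing.Theory.
Local Open Scope ring_scope.

Definition perfect_field (F : fieldType) : Prop :=
  forall p : {poly F}, irreducible_poly p -> separable_poly p.

(* Membership in I^n, for an ideal I and n >= 1: finite sums of n-fold products
   of elements of I; since I absorbs multiplication, no further coefficients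
   from R are needed. *)
Definition in_ideal_pow (R : comPzRingType) (I : {pred R}) (n : nat) (x : R)
    : Prop :=
  exists (m : nat) (a : 'I_m -> 'I_n -> R),
    (forall i j, a i j \in I) /\ x = \sum_(i < m) \prod_(j < n) a i j.

Definition nilpotent_ideal (R : comPzRingType) (I : {pred R}) : Prop :=
  exists n : nat, (1 <= n)%N /\ forall x, in_ideal_pow I n x -> x = 0.

Definition ker_pred (R S : pzRingType) (f : {rmorphism R -> S}) : {pred R} :=
  [pred x | f x == 0].

(* Main.v *)
Require Import Defs.
From HB Require Import structures.
From mathcomp Require Import all_boot all_order all_algebra all_field.
From mathcomp Require Import boolp classical_sets.
From mathcomp Require Import ring.

Set Implicit Arguments.
Unset Strict Implicit.
Unset Printing Implicit Defensive.

Import GRing.Theory.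
Local Open Scope ring_scope.

(** The residue field k lifts to A in steps, through smaller and smaller
subrings of A that still map onto k.  Write I for the kernel of f.

One step is [subring_lift_mod_ideal].  Let S be a subring with f(S) = k, and M
an ideal of A containing all products of two elements of the intersection of S
and I; roughly, S modulo M is a square-zero extension of k.  By Zorn's lemma there is a
maximal subring L of S such that L meets I only inside M and, in
characteristic p, such that L contains the p-th powers of S.  If a is in k,
[exists_lift_small_relations] finds a lift x of a in S such that L[x] still
meets I only inside M; by maximality x is in L, hence f(L) = k.  To find x,
let P be a polynomial over L, nonzero modulo f, of least degree among those
whose image vanishes at a:
- if there is no such P, then any lift x will do;
- if P'(a) is nonzero, a Newton step corrects a lift x so that P(x) is in M;
- if P'(a) = 0, then P' vanishes modulo f by minimality.  This forces
  characteristic p and deg P >= p, so 'X^p - x^p, which is over L and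
  vanishes exactly at every lift x, is also of least degree.
In the last two cases pseudo-division by the relation reduces any Q(x) in I to
a remainder that vanishes modulo f ([horner_mem_ideal_of_min_relation]).
Zorn's lemma needs a subring to start from: the p-th powers of S in
characteristic p (if z is in S and I, then z^p is in M), and the image of the
integers in characteristic 0.  The former is a subring because A, being an
F-algebra, has the same characteristic as k.

For the iteration, M runs through the ideals (0 : I^n): if the elements of S
in I lie in (0 : I^(n+1)), then a product of two of them lies in (0 : I^n).
Nilpotency of I starts this at S = A, and it stops when f is injective on S;
the inverse of the restriction of f to S is then the section. *)

(** * Subrings and ideals *)

Definition is_subring (R : comNzRingType) (X : set R) :=
  [/\ X 1, forall x y, X x -> X y -> X (x - y) &
      forall x y, X x -> X y -> X (x * y)].

(** Zorn's lemma is applied to classical sets, whereas polynomials over a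
subring need bundled boolean predicates; this passes from one to the other. *)
Lemma subringClosed_of_set (R : comNzRingType) (X : set R) :
  is_subring X -> exists L : subringClosed R, forall x, (x \in L) <-> X x.
Proof.
move=> [X1 XB XM].
have closedP : subring_closed (fun x => `[< X x >]).
  by split; [apply/asboolP | move=> x y /asboolP Xx /asboolP Xy; apply/asboolP; auto ..].
pose L : subringClosed R := HB.pack_for (subringClosed R) (fun x => `[< X x >])
  (GRing.isSubringClosed.Build R _ closedP).
by exists L => x; split=> /asboolP.
Qed.

Definition is_ideal (R : comNzRingType) (M : R -> Prop) :=
  [/\ M 0, forall x y, M x -> M y -> M (x + y) & forall a x, M x -> M (a * x)].

(** * Polynomial relations modulo an ideal *)

Lemma horner_taylor2 (R : comNzRingType) (P : {poly R}) (x h : R) :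
  exists v, P.[x + h] = P.[x] + P^`().[x] * h + v * (h * h).
Proof.
elim/poly_ind: P => [|P c [v IH]].
  by exists 0; rewrite deriv0 !horner0; ring.
exists (v * (x + h) + P^`().[x]).
by rewrite derivMXaddC !(hornerD, hornerM, hornerX, hornerC) IH; ring.
Qed.

Lemma horner_mem_ideal (A : comNzRingType) (k : fieldType)
    (f : {rmorphism A -> k})
    (L : subringClosed A) (M : A -> Prop) (Q : {poly A}) (x : A) :
  is_ideal M -> (forall z, z \in L -> f z = 0 -> M z) ->
  Q \is a polyOver L -> map_poly f Q = 0 -> M Q.[x].
Proof.
move=> [M0 MD MM] LM LQ /polyP fQ0; rewrite horner_coef.
apply: big_ind => // i _; rewrite mulrC; apply: MM; apply: LM.
  exact: (polyOverP LQ).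
by have := fQ0 i; rewrite coef_map coef0.
Qed.

(** If P is a relation of least degree for the image of x, then every relation
is a consequence of P, up to M.  L is only a ring, so Q is reduced by
pseudo-division, which multiplies Q(x) by the leading coefficient c of P; this
is undone by y, an inverse of c modulo M. *)
Lemma horner_mem_ideal_of_min_relation (A : comNzRingType) (k : fieldType)
    (f : {rmorphism A -> k})
    (L : subringClosed A) (M : A -> Prop) (P : {poly A}) (x y : A) :
  is_ideal M -> (forall z, z \in L -> f z = 0 -> M z) ->
  P \is a polyOver L -> f P.[x] = 0 -> M P.[x] -> M (1 - lead_coef P * y) ->
  (forall R, R \is a polyOver L -> (size R < size P)%N -> f R.[x] = 0 ->
     map_poly f R = 0) ->
  forall Q, Q \is a polyOver L -> f Q.[x] = 0 -> M Q.[x].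
Proof.
move=> Mid LM LP fPx MPx My minP Q.
have [M0 MD MM] := Mid.
have [n] := ubnP (size Q); elim: n Q => // n IH Q szQ LQ fQx.
have [ltQP|lePQ] := ltnP (size Q) (size P).
  exact: (horner_mem_ideal _ Mid LM LQ (minP _ LQ ltQP fQx)).
have [P0|P0] := eqVneq P 0.
  by have := MM Q.[x] _ My; rewrite P0 lead_coef0 mul0r subr0 mulr1.
have szP_gt0 : (0 < size P)%N by rewrite size_poly_gt0.
have szQ_gt0 : (0 < size Q)%N by exact: leq_trans lePQ.
set c := lead_coef P in My *.
(* One step of pseudo-division: the leading terms of c Q and T P cancel. *)
pose T := (lead_coef Q)%:P * 'X^(size Q - size P) : {poly A}.
pose Q' := c *: Q - T * P.
have LT : T \is a polyOver L.
  by rewrite rpredM ?polyOverC ?polyOverXn ?(polyOverP LQ).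
have LQ' : Q' \is a polyOver L.
  have LcQ : c *: Q \is a polyOver L by apply: polyOverZ => //; apply: (polyOverP LP).
  have LTP : T * P \is a polyOver L by exact: rpredM.
  exact: rpredB.
have szQ' : (size Q' < size Q)%N.
  rewrite -(prednK szQ_gt0) ltnS; apply/leq_sizeP => j lej.
  rewrite coefB coefZ /T -mulrA coefCM mulrC coefXnM.
  rewrite ltnNge (leq_trans _ lej) /=; last first.
    by rewrite -ltnS prednK // ltn_subrL szP_gt0.
  case: (ltngtP j (size Q).-1) lej => // [ltj _|-> _].
    rewrite !nth_default; [by ring | |by rewrite -(prednK szQ_gt0)].
    by rewrite leq_subRL ?(leq_trans (leq_subr _ _)) ?subnK // -(prednK szQ_gt0).
  have -> : ((size Q).-1 - (size Q - size P) = (size P).-1)%N.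
    by rewrite -!subn1 subnAC subKn.
  by rewrite /c /lead_coef; ring.
have Qx' : Q'.[x] = c * Q.[x] - T.[x] * P.[x] by rewrite !hornerE.
have MQ' : M Q'.[x].
  apply: IH => //; first exact: leq_trans szQ' _.
  by rewrite Qx' rmorphB !rmorphM /= fPx fQx; ring.
have -> : Q.[x] = y * (Q'.[x] + T.[x] * P.[x]) + Q.[x] * (1 - c * y).
  by rewrite Qx'; ring.
by apply: (MD); apply: (MM) => //; apply: (MD) => //; apply: (MM).
Qed.

(** * Lifting one element of the residue field *)

(** A lift y of 1 / f c is an inverse of c up to the error 1 - c y, which is in
the kernel; one Newton iteration squares this error, and the square is in M. *)
Lemma inverse_mod_ideal (A : comNzRingType) (k : fieldType)
    (f : {rmorphism A -> k})
    (S : subringClosed A) (M : A -> Prop) (c : A) :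
  (forall a, exists2 x, x \in S & f x = a) ->
  (forall x y, x \in S -> y \in S -> f x = 0 -> f y = 0 -> M (x * y)) ->
  c \in S -> f c != 0 -> exists y, M (1 - c * y).
Proof.
move=> fS SM Sc fc0; have [y Sy fy] := fS (f c)^-1.
exists (y * (2%:R - c * y)).
have -> : 1 - c * (y * (2%:R - c * y)) = (1 - c * y) * (1 - c * y) by ring.
have fcy : f (1 - c * y) = 0 by rewrite rmorphB rmorph1 rmorphM fy divff ?subrr.
have Scy : 1 - c * y \in S by rewrite rpredB ?rpred1 ?rpredM.
exact: SM.
Qed.

(** With y a lift of 1 / f P'(x), put h = - P(x) y.  In the Taylor expansion of
P(x + h), the linear part is P(x) (1 - P'(x) y) and the remainder is a multiple
of h^2: both are products of two elements of S in the kernel. *)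
Lemma newton_lift (A : comNzRingType) (k : fieldType)
    (f : {rmorphism A -> k})
    (S : subringClosed A) (M : A -> Prop) (P : {poly A}) (x : A) :
  is_ideal M -> (forall a, exists2 x, x \in S & f x = a) ->
  (forall x y, x \in S -> y \in S -> f x = 0 -> f y = 0 -> M (x * y)) ->
  P \is a polyOver S -> x \in S -> f P.[x] = 0 -> f P^`().[x] != 0 ->
  exists x', [/\ x' \in S, f x' = f x & M P.[x']].
Proof.
move=> [M0 MD MM] fS SM SP Sx fPx fP'x.
have SPx : P.[x] \in S by rewrite rpred_horner.
have SP'x : P^`().[x] \in S by rewrite rpred_horner ?polyOver_deriv.
have [y Sy fy] := fS (f P^`().[x])^-1.
pose h := - (P.[x] * y).
have Sh : h \in S by rewrite rpredN rpredM.
have fh : f h = 0 by rewrite rmorphN rmorphM /= fPx mul0r oppr0.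
exists (x + h); split; [by rewrite rpredD | by rewrite rmorphD /= fh addr0 |].
have [v ->] := horner_taylor2 P x h.
apply: MD; last by apply: MM; apply: SM.
have -> : P.[x] + P^`().[x] * h = P.[x] * (1 - P^`().[x] * y) by rewrite /h; ring.
apply: SM => //; first by rewrite rpredB ?rpred1 ?rpredM.
by rewrite rmorphB rmorph1 rmorphM /= fy divff ?subrr.
Qed.

(** The conclusion says that the subring L[x] meets the kernel of f only inside
M, as L does: it is what makes L[x] a competitor of L in Zorn's lemma. *)
Lemma exists_lift_small_relations (A : comNzRingType) (k : fieldType)
    (f : {rmorphism A -> k})
    (S L : subringClosed A) (M : A -> Prop) (a : k) :
  is_ideal M -> (forall a, exists2 x, x \in S & f x = a) ->
  (forall x y, x \in S -> y \in S -> f x = 0 -> f y = 0 -> M (x * y)) ->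
  {subset L <= S} -> (forall z, z \in L -> f z = 0 -> M z) ->
  (forall p, p \in [pchar k] -> forall x, x \in S -> x ^+ p \in L) ->
  exists x, [/\ x \in S, f x = a &
    forall Q, Q \is a polyOver L -> f Q.[x] = 0 -> M Q.[x]].
Proof.
move=> Mid fS SM LS LM Lp; have [x0 Sx0 fx0] := fS a.
have hor (Q : {poly A}) x : f x = a -> f Q.[x] = (map_poly f Q).[a].
  by move=> <-; rewrite horner_map.
pose rel_of_size n := `[< exists P : {poly A}, [/\ P \is a polyOver L,
  (map_poly f P).[a] = 0, map_poly f P != 0 & size P = n] >].
have [exP|noP] := EM (exists n, rel_of_size n); last first.
  exists x0; split=> // Q LQ fQ; apply: (horner_mem_ideal _ Mid LM LQ).
  apply/eqP; apply: contra_notT noP => Q0; exists (size Q); apply/asboolP.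
  by exists Q; rewrite -(hor Q x0).
case: (ex_minnP exP) => n /asboolP[P [LP Pa P0 szP]] min_n.
have minP R : R \is a polyOver L -> (size R < size P)%N ->
    (map_poly f R).[a] = 0 -> map_poly f R = 0.
  move=> LR ltR Ra; apply: contraTeq ltR => R0; rewrite -leqNgt szP.
  by apply: min_n; apply/asboolP; exists R.
have Pn0 : P != 0 by apply: contraNneq P0 => ->; rewrite rmorph0.
have szP_gt0 : (0 < size P)%N by rewrite size_poly_gt0.
(* Otherwise P without its leading term would be a smaller relation. *)
have fc0 : f (lead_coef P) != 0.
  apply: contraNneq P0 => fc.
  pose R := P - lead_coef P *: 'X^((size P).-1).
  have fR : map_poly f R = map_poly f P.
    by rewrite rmorphB /= map_polyZ /= fc scale0r subr0.
  rewrite -fR minP ?fR //.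
    have LcX : lead_coef P *: 'X^((size P).-1) \is a polyOver L.
      by apply: polyOverZ; rewrite ?polyOverXn // (polyOverP LP).
    exact: rpredB.
  rewrite -(prednK szP_gt0) ltnS; apply/leq_sizeP => j lej.
  rewrite coefB coefZ coefXn; case: (ltngtP j (size P).-1) lej => // [ltj _|-> _].
    by rewrite nth_default ?mulr0 ?subr0 // -(prednK szP_gt0).
  by rewrite mulr1 /lead_coef subrr.
have [P'a|P'a] := eqVneq (map_poly f P^`()).[a] 0; last first.
  have [x [Sx fx MPx]] : exists x', [/\ x' \in S, f x' = f x0 & M P.[x']].
    apply: newton_lift => //; rewrite ?hor //.
    exact: polyOverS LP.
  have {}fx : f x = a by rewrite fx.
  have [y My] : exists y, M (1 - lead_coef P * y).
    by apply: inverse_mod_ideal fc0 => //; apply: LS; apply: (polyOverP LP).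
  exists x; split=> //; apply: horner_mem_ideal_of_min_relation My _ => //.
    by rewrite hor.
  by move=> R LR ltR; rewrite hor //; apply: minP.
have P'0 : map_poly f P^`() = 0.
  by apply: minP; rewrite ?polyOver_deriv ?lt_size_deriv.
have szP_gt1 : (1 < size P)%N.
  rewrite ltnNge; apply/negP => /size1_polyC Pc.
  by move: Pa P0; rewrite Pc map_polyC hornerC /= => ->; rewrite eqxx.
(* The leading coefficient of P' is deg P times that of P. *)
have d0 : (size P).-1%:R = 0 :> k.
  move/polyP/(_ (size P).-2): P'0.
  rewrite coef_map coef_deriv coef0 /= rmorphMn /= prednK -?subn1 ?subn_gt0 //.
  rewrite subn1 => /eqP; rewrite -mulr_natr mulf_eq0 -/(lead_coef P) (negPf fc0).
  by move/eqP.
have d_gt0 : (0 < (size P).-1)%N by rewrite -subn1 subn_gt0.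
have [p pk] : exists p, p \in [pchar k].
  by have [p] := natf0_pchar d_gt0 (introT eqP d0); exists p.
have p_gt0 : (0 < p)%N by apply: prime_gt0; apply: pcharf_prime pk.
have lepP : (p < size P)%N.
  rewrite -(prednK szP_gt0) ltnS; apply: dvdn_leq => //.
  by rewrite (dvdn_pcharf pk) d0.
(* 'X^p - x0^p has size p + 1 <= size P, so it is of least degree as well. *)
exists x0; split=> //.
have LX : 'X^p - (x0 ^+ p)%:P \is a polyOver L.
  by rewrite rpredB ?polyOverXn // polyOverC Lp.
have X0 : ('X^p - (x0 ^+ p)%:P).[x0] = 0 by rewrite !hornerE subrr.
have [M0 _ _] := Mid.
apply: (horner_mem_ideal_of_min_relation (y := 1) Mid LM LX); rewrite ?X0 ?rmorph0 //.
  by rewrite lead_coefXnsubC // mulr1 subrr.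
move=> R LR; rewrite size_XnsubC // ltnS => ltR; rewrite hor //.
by apply: minP => //; apply: leq_ltn_trans lepP.
Qed.

(** * A maximal subring lifts the residue field modulo M *)

Section Thickening.

Local Open Scope classical_set_scope.

Lemma subring_adjoin (A : comNzRingType) (L : subringClosed A) (x : A) :
  is_subring [set Q.[x] | Q in [set Q | Q \is a polyOver L]].
Proof.
split; first by exists 1; rewrite /= ?rpred1 ?hornerC.
- by move=> _ _ [P LP <-] [Q LQ <-]; exists (P - Q); rewrite /= ?rpredB ?hornerE.
- by move=> _ _ [P LP <-] [Q LQ <-]; exists (P * Q); rewrite /= ?rpredM ?hornerM.
Qed.

Variables (A : comNzRingType) (k : fieldType) (f : {rmorphism A -> k}).
Variables (S : subringClosed A) (M : A -> Prop).

(** Containing the p-th powers of S makes every element of S a root of some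
'X^p - c over the subring, which replaces Newton's method where that fails. *)
Definition admissible (X : set A) :=
  [/\ is_subring X, forall z, X z -> z \in S, forall z, X z -> f z = 0 -> M z &
      forall p, p \in [pchar k] -> forall x, x \in S -> X (x ^+ p)].

Hypothesis pcharA : {subset [pchar k] <= [pchar A]}.
Hypothesis Mid : is_ideal M.
Hypothesis SM : forall x y, x \in S -> y \in S -> f x = 0 -> f y = 0 -> M (x * y).

Lemma admissible_base : exists X, admissible X.
Proof.
have [M0 MD MM] := Mid.
have [[p pk]|nop] := EM (exists p, p \in [pchar k]).
  have pA := pcharA pk.
  exists [set x ^+ p | x in [set x | x \in S]]; split; first split.
  - by exists 1; rewrite /= ?rpred1 ?expr1n.
  - move=> _ _ [x Sx <-] [y Sy <-]; exists (x - y); first by rewrite /= rpredB.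
    by rewrite -!(pFrobenius_autE pA) rmorphB.
  - move=> _ _ [x Sx <-] [y Sy <-]; exists (x * y); first by rewrite /= rpredM.
    by rewrite exprMn.
  - by move=> _ [x Sx <-]; rewrite rpredX.
  - move=> _ [x Sx <-]; rewrite rmorphXn /= => /eqP.
    rewrite expf_eq0 => /andP[_ /eqP fx].
    have := prime_gt1 (pcharf_prime pk); case: (p) => [|[|q]] // _.
    by rewrite exprS exprS mulrA mulrC; apply: MM; apply: SM.
  - by move=> q; rewrite (pcharf_eq pk) => /eqP-> x Sx; exists x.
exists [set n%:~R | n in [set: int]]; split; first split.
- by exists 1.
- by move=> _ _ [m _ <-] [n _ <-]; exists (m - n); rewrite // rmorphB.
- by move=> _ _ [m _ <-] [n _ <-]; exists (m * n); rewrite // rmorphM.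
- by move=> _ [n _ <-]; rewrite rpred_int.
- move=> _ [n _ <-]; rewrite rmorph_int.
  have inj m : m%:R = 0 :> k -> m = 0%N.
    move=> m0; apply/eqP; apply: contra_notT nop; rewrite -lt0n => m_gt0.
    by have [p] := natf0_pchar m_gt0 (introT eqP m0); exists p.
  case: (intP n) => [|m /(inj m.+1)|m] //.
  by rewrite rmorphN /= => /eqP; rewrite oppr_eq0 => /eqP/(inj m.+1).
- by move=> p pk; case: nop; exists p.
Qed.

Lemma admissible_bigcup (F : set (set A)) :
  F !=set0 -> F `<=` admissible -> total_on F subset ->
  admissible (\bigcup_(X in F) X).
Proof.
move=> [X0 FX0] admF totF.
have common X Y : F X -> F Y -> exists Z, [/\ F Z, X `<=` Z & Y `<=` Z].
  by move=> FX FY; have [s|s] := totF _ _ FX FY;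
    [exists Y|exists X]; split=> //; exact: subset_refl.
split; first split.
- by exists X0 => //; have [[X01 _ _] _ _ _] := admF _ FX0.
- move=> x y [X FX Xx] [Y FY Yy]; have [Z [FZ sX sY]] := common _ _ FX FY.
  by exists Z => //; have [[_ ZB _] _ _ _] := admF _ FZ; apply: ZB; auto.
- move=> x y [X FX Xx] [Y FY Yy]; have [Z [FZ sX sY]] := common _ _ FX FY.
  by exists Z => //; have [[_ _ ZM] _ _ _] := admF _ FZ; apply: ZM; auto.
- by move=> z [X /admF[_ XS _ _]]; apply: XS.
- by move=> z [X /admF[_ _ XM _]]; apply: XM.
- by move=> p pk x Sx; exists X0 => //; have [_ _ _ Xp] := admF _ FX0; apply: Xp.
Qed.

(** Zorn's lemma is applied to the admissible sets together with the empty set,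
which is the union of the empty chain.  The empty set is not maximal, since
[admissible_base] is above it. *)
Lemma admissible_maximal :
  exists2 X, admissible X & forall Y, admissible Y -> X `<=` Y -> Y `<=` X.
Proof.
have [B admB] := admissible_base.
have [|X [X0 maxX]] := @Zorn_bigcup A [set X | X = set0 \/ admissible X].
  move=> F admF totF.
  have [F0|] := EM ((F `&` admissible) !=set0); last first.
    move=> noF; left; apply: bigcup0 => X FX.
    by case: (admF _ FX) => // aX; case: noF; exists X.
  right; have -> : \bigcup_(X in F) X = \bigcup_(X in F `&` admissible) X.
    apply/seteqP; split=> z [X FX Xz]; exists X => //; last by case: FX.
    by split=> //; case: (admF _ FX) => [X0|//]; move: Xz; rewrite X0.
  apply: admissible_bigcup => //.
  by move=> X Y [FX _] [FY _]; apply: totF.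
have admX : admissible X.
  case: X0 maxX => // -> maxX; case: (maxX B); last by right.
  by split=> // /(_ 1); have [[B1 _ _] _ _ _] := admB; apply.
exists X => // Y admY XY; apply: contrapT => nYX.
by apply: (maxX Y); [split | right].
Qed.

Hypothesis fS : forall a, exists2 x, x \in S & f x = a.

Lemma subring_lift_mod_ideal : exists L : subringClosed A,
  (forall a, exists2 x, x \in L & f x = a) /\
  (forall z, z \in L -> f z = 0 -> M z).
Proof.
have [X [Xring XS XM Xp] maxX] := admissible_maximal.
have [L LE] := subringClosed_of_set Xring.
have LS : {subset L <= S} by move=> z /LE; apply: XS.
have LM z : z \in L -> f z = 0 -> M z by move=> /LE; apply: XM.
have Lp p : p \in [pchar k] -> forall x, x \in S -> x ^+ p \in L.
  by move=> pk x Sx; apply/LE; apply: Xp.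
exists L; split=> // a.
have [x [Sx fx Mx]] := exists_lift_small_relations a Mid fS SM LS LM Lp.
pose Y := [set Q.[x] | Q in [set Q | Q \is a polyOver L]].
have XY : X `<=` Y.
  by move=> z /LE zL; exists z%:P; rewrite /= ?polyOverC ?hornerC.
have admY : admissible Y.
  split; first exact: subring_adjoin.
  - move=> _ [Q LQ <-]; rewrite rpred_horner //; exact: polyOverS LQ.
  - by move=> _ [Q LQ <-]; apply: Mx.
  - by move=> p pk y Sy; apply: XY; apply: Xp Sy.
exists x => //; apply/LE; apply: (maxX Y admY XY).
by exists 'X; rewrite /= ?polyOverX ?hornerX.
Qed.

End Thickening.

(** * Iteration along the powers of the kernel *)

(** This is the ideal (0 : I^n), where I is the kernel of f. *)
Fixpoint ker_annihilator (A k : nzRingType) (f : A -> k) (n : nat) (x : A) : Prop :=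
  if n is m.+1 then forall y, f y = 0 -> ker_annihilator f m (x * y) else x = 0.

Lemma ker_annihilator_ideal (A : comNzRingType) (k : nzRingType) (f : A -> k) n :
  is_ideal (ker_annihilator f n).
Proof.
elim: n => [|n [M0 MD MM]] /=.
  by split=> [//|x y -> ->|a x ->]; rewrite ?addr0 ?mulr0.
split=> [y _|x y Mx My z fz|a x Mx y fy]; first by rewrite mul0r.
  by rewrite mulrDl; apply: MD; auto.
by rewrite -mulrA; apply: MM; auto.
Qed.

Lemma ker_annihilatorE (A : comNzRingType) (k : nzRingType) (f : A -> k) n x :
  (forall s : 'I_n -> A, (forall i, f (s i) = 0) -> x * \prod_i s i = 0) ->
  ker_annihilator f n x.
Proof.
elim: n x => [|n IH] x Hx /=.
  by have := Hx (fun=> 0) (fun i => False_ind _ (notF (valP i))); rewrite big_ord0 mulr1.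
move=> y fy; apply: IH => s fs.
pose t (i : 'I_n.+1) := if unlift ord0 i is Some j then s j else y.
have tE : \prod_i t i = y * \prod_i s i.
  rewrite big_ord_recl /t unlift_none; congr (_ * _).
  by apply: eq_bigr => i _; rewrite liftK.
by rewrite -mulrA -tE; apply: Hx => i; rewrite /t; case: unliftP.
Qed.

Lemma section_of_subring (A : comNzRingType) (k : fieldType)
    (f : {rmorphism A -> k})
    (S : subringClosed A) :
  (forall a, exists2 x, x \in S & f x = a) ->
  (forall z, z \in S -> f z = 0 -> z = 0) ->
  exists g : {rmorphism k -> A}, forall x, f (g x) = x.
Proof.
move=> fS injS.
have /choice[g gP] a : exists x, x \in S /\ f x = a.
  by have [x] := fS a; exists x.
have gE z : z \in S -> g (f z) = z.
  move=> Sz; have [Sg fg] := gP (f z).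
  apply/subr0_eq/injS; first by rewrite rpredB.
  by rewrite rmorphB /= fg subrr.
have gB : zmod_morphism g.
  move=> a b; have [Sa fa] := gP a; have [Sb fb] := gP b.
  by rewrite -[a in LHS]fa -[b in LHS]fb -rmorphB gE ?rpredB.
have gM : monoid_morphism g.
  split; first by rewrite -(rmorph1 f) gE ?rpred1.
  move=> a b; have [Sa fa] := gP a; have [Sb fb] := gP b.
  by rewrite -[a in LHS]fa -[b in LHS]fb -rmorphM gE ?rpredM.
pose gg : {rmorphism k -> A} := HB.pack_for {rmorphism k -> A} g
  (GRing.isZmodMorphism.Build k A g gB) (GRing.isMonoidMorphism.Build k A g gM).
by exists gg => x; have [] := gP x.
Qed.

(** If S meets the kernel I inside (0 : I^(n+1)), the product of two elements
of S in I lies in (0 : I^n), since one factor is in (0 : I^(n+1)) and the other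
in I.  So a lifting step with M = (0 : I^n) lowers the exponent by one. *)
Lemma section_of_annihilated_ker (A : comNzRingType) (k : fieldType)
    (f : {rmorphism A -> k}) n
    (S : subringClosed A) :
  {subset [pchar k] <= [pchar A]} ->
  (forall a, exists2 x, x \in S & f x = a) ->
  (forall z, z \in S -> f z = 0 -> ker_annihilator f n z) ->
  exists g : {rmorphism k -> A}, forall x, f (g x) = x.
Proof.
move=> pcharA; elim: n S => [|n IH] S fS SM; first exact: section_of_subring fS SM.
have [|L [fL LM]] := subring_lift_mod_ideal pcharA (ker_annihilator_ideal f n) _ fS.
  by move=> x y Sx Sy fx fy; apply: (SM x).
exact: IH fL LM.
Qed.

(* The scaling law iota \; *%R is the F-algebra structure of k given by the
   field extension iota, so f is a morphism of F-algebras. *)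
Theorem lemma1p2 (F k : fieldType) (iota : {rmorphism F -> k})
    (A : comAlgType F) (f : {lrmorphism A -> k | iota \; *%R}) :
  perfect_field F ->
  (forall y : k, exists x : A, f x = y) ->
  nilpotent_ideal (ker_pred f) ->
  exists g : {rmorphism k -> A}, forall x : k, f (g x) = x.
Proof.
move=> _ fsurj [n [_ nilp]].
have pcharA : {subset [pchar k] <= [pchar A]}.
  move=> p pk; have pF : p \in [pchar F] by rewrite -(fmorph_pchar iota).
  by rewrite inE (pcharf_prime pF) -(scaler_nat p (1 : A)) (pcharf0 pF) scale0r eqxx.
have [T TE] :=
  @subringClosed_of_set A setT (And3 I (fun _ _ _ _ => I) (fun _ _ _ _ => I)).
apply: (@section_of_annihilated_ker A k f n T pcharA).
  by move=> a; have [x fx] := fsurj a; exists x => //; apply/TE.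
move=> z _ fz; apply: ker_annihilatorE => s fs.
suff -> : \prod_i s i = 0 by rewrite mulr0.
apply: nilp; exists 1%N, (fun=> s); split; last by rewrite big_ord1.
by move=> _ i; rewrite inE fs.
Qed.
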